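(* Let $\bm{x}_{n+1}=\bm{\Phi}(\bm{x}_n)$ be a deterministic dynamical system preserving a probability measure $\mu$, let $\overline{(\cdot)}$ be a coarse-graining map into $\mathbb{R}^d$, and let $\bar\mu$ be the pushforward of $\mu$ under $\overline{(\cdot)}$, assumed to have finite second moment. Let $\bm{x}_n\sim\mu$ (so $\overline{\bm{x}}_n\sim\bar\mu$). For each parameter value $\bm{\theta}$, let $\widetilde{\bm{x}}_{n+k+1}=\bm{F}_{\bm{\theta}}(\widetilde{\bm{x}}_{n+k},\bm{\xi}_{n+k})$, $k\ge0$, with $\widetilde{\bm{x}}_n=\overline{\bm{x}}_n$, where the noise variables are independent of each other and of $\bm{x}_n$. For $m\ge1$ let $Q_m(\cdot\mid\overline{\bm{x}}_n)$ be the conditional law of $\overline{\bm{x}}_{n+m}$ given $\overline{\bm{x}}_n$, and $\widetilde{\mathbb{P}}_{\bm{\theta},m}(\cdot\mid\overline{\bm{x}}_n)$ the conditional law of $\widetilde{\bm{x}}_{n+m}$ given $\overline{\bm{x}}_n$. Let $\mathcal{S}(P,\bm{y})$ be a strictly proper scoring rule on $\mathcal{P}_2$, and define $$f_{m,\bm{\theta}}(\overline{\bm{x}}_n)=\mathbb{E}_{\overline{\bm{y}}\sim Q_m(\cdot\mid\overline{\bm{x}}_n)}\Big[\mathcal{S}\big(\widetilde{\mathbb{P}}_{\bm{\theta},m}(\cdot\mid\overline{\bm{x}}_n),\overline{\bm{y}}\big)\Big],\qquad \mathcal{L}_m(\bm{\theta})=\mathbb{E}_{\overline{\bm{x}}_n\sim\bar\mu}\big[f_{m,\bm{\theta}}(\overline{\bm{x}}_n)\big].$$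 Assume: 1. For $\bar\mu$-almost every $\overline{\bm{x}}_n$, $Q_m(\cdot\mid\overline{\bm{x}}_n)\xrightarrow{W_2}\bar\mu$ as $m\to\infty$. 2. For $\bar\mu$-almost every $\overline{\bm{x}}_n$, $\widetilde{\mathbb{P}}_{\bm{\theta},m}(\cdot\mid\overline{\bm{x}}_n)\xrightarrow{W_2}\widetilde{\mathbb{P}}_{\bm{\theta},\infty}(\cdot\mid\overline{\bm{x}}_n)$ as $m\to\infty$, for some limit law $\widetilde{\mathbb{P}}_{\bm{\theta},\infty}(\cdot\mid\overline{\bm{x}}_n)\in\mathcal{P}_2$. 3. The functional $(P,Q)\mapsto\mathbb{E}_{\bm{y}\sim Q}[\mathcal{S}(P,\bm{y})]$ is jointly continuous with respect to $W_2\times W_2$ on $\mathcal{P}_2\times\mathcal{P}_2$. 4. For each fixed $\bm{\theta}$, the sequence $\{f_{m,\bm{\theta}}(\overline{\bm{x}}_n)\}_{m\ge1}$ is uniformly integrable under $\bar\mu$. Then $$\lim_{m\to\infty}\mathcal{L}_m(\bm{\theta})=\mathbb{E}_{\overline{\bm{x}}_n\sim\bar\mu}\Big[d_{\mathcal{S}}\big(\widetilde{\mathbb{P}}_{\bm{\theta},\infty}(\cdot\mid\overline{\bm{x}}_n),\bar\mu\big)\Big]+\mathbb{E}_{\overline{\bm{y}}\sim\bar\mu}\big[\mathcal{S}(\bar\mu,\overline{\bm{y}})\big],$$ where $d_{\mathcal{S}}(P,Q)=\mathbb{E}_{\bm{y}\sim Q}[\mathcal{S}(P,\bm{y})]-\mathbb{E}_{\bm{y}\sim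 Q}[\mathcal{S}(Q,\bm{y})]$ is the divergence induced by $\mathcal{S}$. Consequently, since the second term does not depend on $\bm{\theta}$, the parameter-dependent part of the asymptotic objective is exactly the expected divergence between the model's long-lead predictive law and $\bar\mu$.
   Context: $\bm{\Phi}$ is a measurable map on the full state space, and the coarse-graining map $\bm{x}\mapsto\overline{\bm{x}}$ is a measurable map from the full state space to the resolved (coarse-grained) space $\mathbb{R}^d$. The true resolved process is $\overline{\bm{x}}_{n+m}=\overline{\bm{\Phi}^m(\bm{x}_n)}$. $\bm{F}_{\bm{\theta}}$ is a measurable map for each $\bm{\theta}$ in a parameter set. $\mathcal{P}_2$ is the set of Borel probability measures on the resolved space with finite second moment, and $W_2$ is the 2-Wasserstein distance on it; conditional laws are regular conditional distributions, in $\mathcal{P}_2$ for $\bar\mu$-a.e. $\overline{\bm{x}}_n$. A scoring rule on $\mathcal{P}_2$ is a real-valued function $\mathcal{S}(P,\bm{y})$ of a forecast law $P\in\mathcal{P}_2$ and an outcome $\bm{y}$ (smaller is better), with $\mathbb{E}_{\bm{y}\sim Q}[\mathcal{S}(P,\bm{y})]$ finite for $P,Q\in\mathcal{P}_2$. It is strictly proper if for every $Q\in\mathcal{P}_2$ the correct forecast uniquely minimizes the expected score: $\mathbb{E}_{\bm{y}\sim Q}[\mathcal{S}(Q,\bm{y})]\le\mathbb{E}_{\bm{y}\sim Q}[\mathcal{S}(P,\bm{y})]$ for all $P\in\mathcal{P}_2$, with equality if and only if $P=Q$. Equivalently $d_{\mathcal{S}}(P,Q)\ge0$, with equality if and only if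 $P=Q$. *)

(* Defs.v *)
From HB Require Import structures.
From mathcomp Require Export all_boot all_order all_algebra.
From mathcomp Require Export all_classical all_reals all_analysis measurable_realfun.

Set Implicit Arguments.
Unset Strict Implicit.
Unset Printing Implicit Defensive.

Import Order.TTheory GRing.Theory Num.Theory numFieldNormedType.Exports.

Local Open Scope classical_set_scope.
Local Open Scope ring_scope.

(* R^d is [d.-tuple R]: the library's sigma-algebra on it is generated by the
   coordinates, i.e. it is the Borel one.  The norm is the Euclidean one. *)
Definition sqdist (R : realType) (d : nat) (u v : d.-tuple R) : R :=
  \sum_(i < d) (tnth u i - tnth v i) ^+ 2.

Definition finite_second_moment (R : realType) (d : nat)
    (P : probability (d.-tuple R) R) : Prop :=
  (\int[P]_y (\sum_(i < d) tnth y i ^+ 2)%:E < +oo)%E.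

Definition P2 (R : realType) (d : nat) : set (probability (d.-tuple R) R) :=
  [set P | finite_second_moment P].

(* A measure of the library is a function on all sets which is constrained only
   on the measurable ones, so equality of laws is equality on measurable sets
   and not Leibniz equality. *)
Definition same_law (disp : measure_display) (T : measurableType disp)
    (R : realType) (P Q : probability T R) : Prop :=
  forall A : set T, measurable A -> P A = Q A.

Definition coupling (R : realType) (d : nat)
    (P Q : probability (d.-tuple R) R) :
    set (probability (d.-tuple R * d.-tuple R)%type R) :=
  [set g | forall A : set (d.-tuple R), measurable A ->
           g (A `*` setT) = P A /\ g (setT `*` A) = Q A].

Definition W2 (R : realType) (d : nat) (P Q : probability (d.-tuple R) R) :
    \bar R :=
  sqrte (ereal_inf
    [set (\int[g]_z (sqdist z.1 z.2)%:E)%E | g in coupling P Q]).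

(* Forecasts are only meant to range over P2; the values of S at other laws are
   never constrained. *)
Definition scoring_rule (R : realType) (d : nat)
    (S : probability (d.-tuple R) R -> d.-tuple R -> R) : Prop :=
  forall P Q : probability (d.-tuple R) R, P2 P -> P2 Q ->
    Q.-integrable setT (fun y => (S P y)%:E).

Definition expected_score (R : realType) (d : nat)
    (S : probability (d.-tuple R) R -> d.-tuple R -> R)
    (P Q : probability (d.-tuple R) R) : R :=
  \int[Q]_y S P y.

Definition strictly_proper (R : realType) (d : nat)
    (S : probability (d.-tuple R) R -> d.-tuple R -> R) : Prop :=
  forall P Q : probability (d.-tuple R) R, P2 P -> P2 Q ->
    expected_score S Q Q <= expected_score S P Q /\
    (expected_score S Q Q = expected_score S P Q <-> same_law P Q).

Definition score_divergence (R : realType) (d : nat)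
    (S : probability (d.-tuple R) R -> d.-tuple R -> R)
    (P Q : probability (d.-tuple R) R) : R :=
  expected_score S P Q - expected_score S Q Q.

Definition W2_jointly_continuous (R : realType) (d : nat)
    (G : probability (d.-tuple R) R -> probability (d.-tuple R) R -> R) :
    Prop :=
  forall P Q : probability (d.-tuple R) R, P2 P -> P2 Q ->
  forall e : R, 0 < e -> exists2 r : R, 0 < r &
  forall P' Q' : probability (d.-tuple R) R, P2 P' -> P2 Q' ->
    (W2 P' P < r%:E)%E -> (W2 Q' Q < r%:E)%E -> `|G P' Q' - G P Q| < e.

(* Members of the family are required to be measurable only up to a null set:
   below they are built from conditional laws, which are in P2 only almost
   everywhere. *)
Definition uniformly_integrable (disp : measure_display)
    (T : measurableType disp) (R : realType) (mu : probability T R)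
    (I : Type) (f : I -> T -> R) : Prop :=
  (forall i : I, exists2 g : T -> R,
     measurable_fun setT g & {ae mu, forall x, f i x = g x}) /\
  (ereal_sup [set (\int[mu]_(x in [set x | (K < `|f i x|)%R]) `|f i x|%:E)%E
             | i in [set: I]] @[K --> +oo%R] --> 0%E).

(* K is a regular conditional distribution of V given U under Pr. *)
Definition regular_cond_law (dO dU dV : measure_display)
    (Omega : measurableType dO) (TU : measurableType dU)
    (TV : measurableType dV) (R : realType) (Pr : probability Omega R)
    (U : Omega -> TU) (V : Omega -> TV) (K : TU -> probability TV R) : Prop :=
  (forall B : set TV, measurable B ->
     measurable_fun setT (K ^~ B)) /\
  (forall (A : set TU) (B : set TV), measurable A -> measurable B ->
     Pr (U @^-1` A `&` V @^-1` B) =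
     (\int[Pr]_(w in U @^-1` A) K (U w) B)%E).

Definition generated_sigma_algebra (dO dT : measure_display)
    (Omega : measurableType dO) (T : measurableType dT) (V : Omega -> T) :
    set (set Omega) :=
  preimage_set_system setT V measurable.

Definition mutually_independent (dO : measure_display)
    (Omega : measurableType dO) (R : realType) (Pr : probability Omega R)
    (I : choiceType) (C : I -> set (set Omega)) : Prop :=
  forall (J : seq I) (A : I -> set Omega), uniq J ->
    (forall i, i \in J -> C i (A i)) ->
    Pr (\bigcap_(i in [set` J]) A i) = (\prod_(i <- J) Pr (A i))%E.

Fixpoint model_orbit (Y E : Type) (F : Y * E -> Y) (y0 : Y) (e : nat -> E)
    (k : nat) : Y :=
  if k is j.+1 then F (model_orbit F y0 e j, e j) else y0.

(* Main.v *)
(* Joint continuity of the expected score makes f_m converge almost everywhere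
   to the expected score of the limit law under the invariant law, and Vitali's
   theorem passes the limit under the integral.  Vitali's theorem is reduced to
   dominated convergence by truncating at a level K: uniform integrability makes
   the integral of the excess |x - clamp K x| over K uniformly small, and Fatou's
   lemma transfers this bound to the limit. *)
Require Import Defs.
From mathcomp Require Import lra.

Set Implicit Arguments.
Unset Strict Implicit.
Unset Printing Implicit Defensive.

Import Order.TTheory GRing.Theory Num.Theory numFieldNormedType.Exports.

Local Open Scope classical_set_scope.
Local Open Scope ring_scope.

(** * Integrals compared up to null sets *)

Section ae_integrals.
Context (disp : measure_display) (T : measurableType disp) (R : realType)
  (mu : {measure set T -> \bar R}).
Local Open Scope ereal_scope.

Import HBNNSimple.

(* Unlike [ae_ge0_le_integral], no measurability: the integral of the library
   is defined for arbitrary functions, as a supremum over simple ones. *)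
Lemma ge0_le_integral_ae (f g : T -> \bar R) :
  (forall x, 0 <= f x) -> (forall x, 0 <= g x) ->
  {ae mu, forall x, f x <= g x} -> \int[mu]_x f x <= \int[mu]_x g x.
Proof.
move=> f0 g0 [N [mN N0 fgN]].
rewrite [leLHS]ge0_integralTE// ge_ereal_sup// => _ [h /= hf <-].
(* Cutting [h] to zero on the null set [N] keeps its integral and puts it below [g] everywhere, so
   it enters the supremum that defines the integral of [g]. *)
pose h' := proj_nnsfun h (measurableC mN).
have -> : sintegral mu h = sintegral mu h'.
  rewrite -!integralT_nnsfun; apply: ge0_ae_eq_integral => //.
  - exact/measurable_EFinP.
  - exact/measurable_EFinP.
  - by move=> x _; rewrite lee_fin.
  - by move=> x _; rewrite lee_fin.
  - exists N; split => // x; apply: contra_notP => Nx _ /=.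
    by rewrite mindicE mem_set// mulr1.
rewrite ge0_integralTE//; apply: ereal_sup_ubound; exists h' => //= x.
rewrite mindicE; have [|_] := boolP (x \in _); last by rewrite mulr0.
rewrite inE => Nx; rewrite mulr1 (le_trans (hf x))//.
by apply: contrapT => /(fgN x).
Qed.

(** Positive and negative parts are compared in both directions. Meant for integrands not known to
    be measurable, such as expected scores of conditional laws. *)
Lemma integral_ae_eq (f g : T -> \bar R) :
  {ae mu, forall x, f x = g x} -> \int[mu]_x f x = \int[mu]_x g x.
Proof.
move=> fg; rewrite integralE [RHS]integralE; congr (_ - _);
  by apply/eqP; rewrite eq_le !ge0_le_integral_ae//; apply: filterS fg => x;
    rewrite (funeposE, funenegE) (funeposE, funenegE) => ->.
Qed.

Lemma le_integral_fatou (f_ : (T -> \bar R)^nat) (f : T -> \bar R)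
    (c : \bar R) :
  (forall n, measurable_fun setT (f_ n)) -> (forall n x, 0 <= f_ n x) ->
  (forall x, f_ ^~ x @ \oo --> f x) ->
  (forall n, \int[mu]_x f_ n x <= c) -> \int[mu]_x f x <= c.
Proof.
move=> mf_ f_0 f_f f_c.
have -> : \int[mu]_x f x = \int[mu]_x limn_einf (f_ ^~ x).
  by apply: eq_integral => x _; rewrite (cvg_limn_einf_sup (f_f x)).
apply: (le_trans (fatou _ _ _ _)) => //.
rewrite limn_einf_lim; apply: lime_le; first exact: is_cvg_einfs.
apply: nearW => n; apply: le_trans (f_c n); apply: ereal_inf_lbound.
by exists n => /=.
Qed.

End ae_integrals.

(** * Truncation of real numbers *)

Section clamp.
Context (R : realType).

Definition clamp (K x : R) : R := Num.max (- K) (Num.min K x).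

(** For [0 <= K] this is max(|x| - K, 0). Unlike the tail |x| 1_{K < |x|}, it is continuous in [x],
    hence passes to pointwise limits. *)
Definition excess (K x : R) : R := `|x - clamp K x|.

Lemma normr_clamp_le (K x : R) : 0 <= K -> `|clamp K x| <= K.
Proof.
move=> K0; rewrite /clamp.
by case: (leP K x) => ?; case: (leP (- K) _) => ?; rewrite ler_norml; lra.
Qed.

Lemma excess_ge0 (K x : R) : 0 <= excess K x.
Proof. exact: normr_ge0. Qed.

Lemma excess_le (K x : R) :
  0 <= K -> excess K x <= if K < `|x| then `|x| else 0.
Proof.
move=> K0; rewrite /excess /clamp.
by have [x0|x0] := lerP 0 x; case: (leP K x) => ?; case: (leP (- K) _) => ?;
  rewrite ?(ger0_norm x0) ?(ltr0_norm x0); case: ltP => ?;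
  rewrite ?ler_norml; lra.
Qed.

Lemma clamp_lipschitz (K x y : R) : `|clamp K x - clamp K y| <= `|x - y|.
Proof.
rewrite /clamp; case: (leP K x) => ?; case: (leP K y) => ?;
  case: (leP (- K) _) => ?; try (case: (leP (- K) _) => ?);
  rewrite ler_norml; case: (ger0P (x - y)) => ?; lra.
Qed.

Lemma cvg_clamp (K : R) (u : R^nat) (l : R) :
  u @ \oo --> l -> clamp K (u n) @[n --> \oo] --> clamp K l.
Proof.
move=> /cvgrPdist_le ul; apply/cvgrPdist_le => e /ul; apply: filterS => n.
exact/le_trans/clamp_lipschitz.
Qed.

Lemma cvg_excess (K : R) (u : R^nat) (l : R) :
  u @ \oo --> l -> excess K (u n) @[n --> \oo] --> excess K l.
Proof. by move=> ul; apply: cvg_norm; apply: cvgB => //; exact: cvg_clamp. Qed.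

End clamp.

(** * Vitali's convergence theorem *)

Section vitali.
Context (disp : measure_display) (T : measurableType disp) (R : realType)
  (mu : probability T R).

Lemma measurable_clamp (K : R) (f : T -> R) :
  measurable_fun setT f -> measurable_fun setT (clamp K \o f).
Proof.
by move=> mf; apply: measurable_maxr => //; exact: measurable_minr.
Qed.

Lemma measurable_excess (K : R) (f : T -> R) :
  measurable_fun setT f -> measurable_fun setT (excess K \o f).
Proof.
move=> mf.
by have /(measurableT_comp (@normr_measurable R setT)) :=
  measurable_funB mf (measurable_clamp K mf).
Qed.

Lemma uniformly_integrable_excess (I : Type) (f : I -> T -> R) (e : R) :
  uniformly_integrable mu f -> 0 < e ->
  exists2 K : R, 0 <= K &
    forall i, (\int[mu]_x (excess K (f i x))%:E <= e%:E)%E.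
Proof.
move=> [_ ui] e0.
have /ui : nbhs 0%E [set y : \bar R | (y < e%:E)%E].
  exact: (@nbhs_open_ereal_lt R 0 (fun=> e)).
move=> /(filterI (nbhs_pinfty_ge (num_real (0 : R))))/filter_ex[K [K0 Ke]].
exists K => // i; apply: le_trans (ltW Ke).
apply: le_trans; last by apply: ereal_sup_ubound; exists i.
(* [f i] is only almost everywhere equal to a measurable function, so the comparison must do without
   measurability. *)
rewrite [leRHS]integral_mkcond; apply: ge0_le_integral_ae.
- by move=> x; rewrite lee_fin excess_ge0.
- by move=> x; rewrite patchE; case: ifP => // _; rewrite lee_fin.
- apply: aeW => x; rewrite patchE; have := excess_le (f i x) K0.
  rewrite (_ : (x \in _) = (K < `|f i x|)); last first.
    by apply/idP/idP => [/set_mem|/mem_set].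
  by case: ifP; rewrite lee_fin.
Qed.

Lemma integrable_clamp (K : R) (f : T -> R) : 0 <= K ->
  measurable_fun setT f -> mu.-integrable setT (EFin \o (clamp K \o f)).
Proof.
move=> K0 mf; apply: measurable_bounded_integrable => //.
- exact: fin_num_fun_lty.
- exact: measurable_clamp.
- exists K; split; first exact: num_real.
  by move=> M KM x _; apply: le_trans (normr_clamp_le _ K0) (ltW KM).
Qed.

(** [f] is its clamp, bounded and so integrable under a probability, plus a remainder whose absolute
    value is the excess. *)
Lemma integrable_excess (K : R) (f : T -> R) : 0 <= K ->
  measurable_fun setT f ->
  (\int[mu]_x (excess K (f x))%:E < +oo)%E ->
  mu.-integrable setT (EFin \o f).
Proof.
move=> K0 mf foo.
have -> : EFin \o f =
    ((EFin \o (f \- (clamp K \o f))%R) \+ (EFin \o (clamp K \o f)))%E.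
  by apply/funext => x /=; rewrite -EFinD subrK.
apply: integrableD => //; last exact: integrable_clamp.
apply/integrableP; split => //; apply/measurable_EFinP.
exact: (measurable_funB mf (measurable_clamp K mf)).
Qed.

(** The difference is the integral of [f - clamp K f], whose absolute value is the excess. The bound
    also makes [f] integrable, so its real-valued integral is not a default value. *)
Lemma normr_Rintegral_clamp_le (K e : R) (f : T -> R) : 0 <= K ->
  measurable_fun setT f ->
  (\int[mu]_x (excess K (f x))%:E <= e%:E)%E ->
  `|\int[mu]_x f x - \int[mu]_x clamp K (f x)| <= e.
Proof.
move=> K0 mf fe.
have fi : mu.-integrable setT (EFin \o f).
  by apply: (integrable_excess K0 mf); rewrite (le_lt_trans fe)// ltry.
have ci := integrable_clamp K0 mf.
have fci : mu.-integrable setT (EFin \o (fun x => f x - clamp K (f x))).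
  by have := integrableB measurableT fi ci.
rewrite -RintegralB// -lee_fin EFin_normr_Rintegral//; apply: le_trans fe.
apply: le_abse_integral => //; exact/(measurable_int _ fci).
Qed.

Lemma vitali_measurable (f_ : (T -> R)^nat) (f : T -> R) :
  (forall n, measurable_fun setT (f_ n)) -> measurable_fun setT f ->
  (forall x, f_ ^~ x @ \oo --> f x) ->
  (forall e : R, 0 < e -> exists2 K : R, 0 <= K & forall n,
     (\int[mu]_x (excess K (f_ n x))%:E <= e%:E)%E) ->
  mu.-integrable setT (EFin \o f) /\
  (\int[mu]_x (f_ n x)%:E)%E @[n --> \oo] --> (\int[mu]_x (f x)%:E)%E.
Proof.
move=> mf_ mf f_f tail.
have ftail K e : 0 <= K ->
    (forall n, (\int[mu]_x (excess K (f_ n x))%:E <= e%:E)%E) ->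
    (\int[mu]_x (excess K (f x))%:E <= e%:E)%E.
  move=> K0; apply: le_integral_fatou.
  - move=> n; apply/measurable_EFinP; exact: measurable_excess.
  - by move=> n x; rewrite lee_fin excess_ge0.
  - move=> x; apply: cvg_EFin; first exact: nearW.
    exact: cvg_excess.
(* The bound 1 is arbitrary: a finite excess integral suffices for integrability. *)
have [K1 K10 f_1] := tail 1 ltr01.
have fi : mu.-integrable setT (EFin \o f).
  apply: (integrable_excess K10 mf).
  by rewrite (le_lt_trans (ftail _ _ K10 f_1))// ltry.
have f_i n : mu.-integrable setT (EFin \o f_ n).
  apply: (integrable_excess K10 (mf_ n)).
  by rewrite (le_lt_trans (f_1 n))// ltry.
split => //.
rewrite -[X in _ --> X]fineK ?integrable_fin_num//; apply: cvg_EFin.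
  by apply: nearW => n; apply: (integrable_fin_num measurableT (f_i n)).
apply/cvgrPdist_le => e e0.
(* One third each for truncating [f_ n], for truncating [f], and for the dominated convergence of
   the clamps. *)
have e30 : 0 < e / 3 by rewrite divr_gt0.
have [K K0 f_e] := tail _ e30.
have : \int[mu]_x clamp K (f_ n x) @[n --> \oo] --> \int[mu]_x clamp K (f x).
  apply: fine_cvg; rewrite fineK; last first.
    exact: (integrable_fin_num measurableT (integrable_clamp K0 mf)).
  have [] := @dominated_convergence _ T R mu setT measurableT
    (fun n => EFin \o (clamp K \o f_ n)) (EFin \o (clamp K \o f)) (cst K%:E).
  - by move=> n; apply/measurable_EFinP; exact: measurable_clamp.
  - by apply/measurable_EFinP; exact: measurable_clamp.
  - apply: aeW => x _; apply: cvg_EFin; first exact: nearW.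
    exact: cvg_clamp.
  - exact: finite_measure_integrable_cst.
  - by apply: aeW => x n _ /=; rewrite lee_fin normr_clamp_le.
  - by [].
move=> /cvgrPdist_le/(_ _ e30); apply: filterS => n.
have := normr_Rintegral_clamp_le K0 mf (ftail _ _ K0 f_e).
have := normr_Rintegral_clamp_le K0 (mf_ n) (f_e n).
rewrite !ler_norml /Rintegral/=; lra.
Qed.

(** An almost-everywhere limit need not be measurable on a non-complete space, so the limit integral
    is that of an integrable representative [g]. *)
Lemma vitali (f_ : (T -> R)^nat) (f : T -> R) :
  uniformly_integrable mu f_ ->
  {ae mu, forall x, f_ ^~ x @ \oo --> f x} ->
  exists g : T -> R, [/\ mu.-integrable setT (EFin \o g),
    {ae mu, forall x, f x = g x} &
    (\int[mu]_x (f_ n x)%:E)%E @[n --> \oo] --> (\int[mu]_x (g x)%:E)%E].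
Proof.
move=> ui f_f.
have [/(_ _)/cid2 - /all_sig2[g mg /ae_foralln f_g] _] := ui.
have [N [mN N0 subN]] : {ae mu, forall x,
    (forall n, f_ n x = g n x) /\ f_ ^~ x @ \oo --> f x}.
  by apply: filterS2 f_g f_f.
have {}subN x : ~ N x -> (forall n, f_ n x = g n x) /\ f_ ^~ x @ \oo --> f x.
  by move=> Nx; apply: contrapT => /(subN x).
(* Off the single null set [N], every [f_ n] equals its measurable representative and the sequence
   converges. Setting everything to zero on [N] makes convergence hold everywhere and the limit
   measurable. *)
pose h n := g n \_ (~` N); pose h0 := f \_ (~` N).
have f_h n : {ae mu, forall x, f_ n x = h n x}.
  exists N; split => // x; apply: contra_notP => Nx.
  by rewrite /= /h patchE mem_set//; have [-> _] := subN _ Nx.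
have fh : {ae mu, forall x, f x = h0 x}.
  by exists N; split => // x; apply: contra_notP => Nx;
    rewrite /= /h0 patchE mem_set.
have mh n : measurable_fun setT (h n).
  apply/(measurable_restrictT _ (measurableC mN)); exact: measurable_funTS.
have hh0 x : h ^~ x @ \oo --> h0 x.
  rewrite /h /h0; under eq_fun do rewrite patchE; rewrite patchE.
  case: ifPn => [|_]; last exact: cvg_cst.
  rewrite inE => Nx; have [f_gx] := subN _ Nx.
  by under eq_fun do rewrite f_gx.
have mh0 : measurable_fun setT h0 by apply: (measurable_fun_cvg mh) => x _.
have [|ih0 hcvg] := vitali_measurable mh mh0 hh0.
  move=> e /(uniformly_integrable_excess ui)[K K0 f_e]; exists K => // n.
  rewrite (le_trans _ (f_e n))// le_eqVlt; apply/orP; left; apply/eqP.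
  by apply: integral_ae_eq; apply: filterS (f_h n) => x ->.
exists h0; split => //.
rewrite (_ : (fun n => \int[mu]_x (f_ n x)%:E)%E =
  (fun n => \int[mu]_x (h n x)%:E)%E)//; apply/funext => n.
by apply: integral_ae_eq; apply: filterS (f_h n) => x ->.
Qed.

End vitali.

(** * Wasserstein continuity and the limit of the objective *)

Lemma W2_jointly_continuous_cvg (R : realType) (d : nat)
    (G : probability (d.-tuple R) R -> probability (d.-tuple R) R -> R)
    (P_ Q_ : nat -> probability (d.-tuple R) R)
    (P Q : probability (d.-tuple R) R) :
  W2_jointly_continuous G -> (forall m, P2 (P_ m)) -> (forall m, P2 (Q_ m)) ->
  P2 P -> P2 Q ->
  W2 (P_ m) P @[m --> \oo] --> 0%E -> W2 (Q_ m) Q @[m --> \oo] --> 0%E ->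
  G (P_ m) (Q_ m) @[m --> \oo] --> G P Q.
Proof.
move=> Gcont P_2 Q_2 P2P P2Q P_P Q_Q; apply/cvgrPdist_lt => e e0.
have [r r0 Gr] := Gcont _ _ P2P P2Q _ e0.
have small : nbhs 0%E [set y : \bar R | (y < r%:E)%E].
  exact: (@nbhs_open_ereal_lt R 0 (fun=> r)).
near=> m; rewrite distrC; apply: Gr => //; near: m.
- exact: P_P small.
- exact: Q_Q small.
Unshelve. all: by end_near.
Qed.

Theorem proposition2 (R : realType) (d : nat)
  (dX dE dO : measure_display)
  (X : measurableType dX) (E : measurableType dE) (Omega : measurableType dO)
  (* the dynamics, its invariant law, the coarse-graining *)
  (Phi : {mfun X >-> X}) (mu : probability X R)
  (mu_invariant : forall A, measurable A -> mu (Phi @^-1` A) = mu A)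
  (coarse : {mfun X >-> d.-tuple R})
  (mubar := distribution mu coarse : probability (d.-tuple R) R)
  (mubar_P2 : P2 mubar)
  (* the true process *)
  (Pr : probability Omega R) (x : nat -> {RV Pr >-> X})
  (x_step : forall k w, x k.+1 w = Phi (x k w))
  (n : nat)
  (x_law : forall A, measurable A -> distribution Pr (x n) A = mu A)
  (* the stochastic model *)
  (Theta : Type)
  (F : Theta -> {mfun (d.-tuple R * E)%type >-> d.-tuple R})
  (xi : nat -> {RV Pr >-> E})
  (noise_indep : mutually_independent Pr
     (fun i : option nat =>
        if i is Some k then generated_sigma_algebra (xi (n + k)%N)
        else generated_sigma_algebra (x n)))
  (* the conditional laws at lead m *)
  (Q : nat -> d.-tuple R -> probability (d.-tuple R) R)
  (Q_cond : forall m, (0 < m)%N ->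
     regular_cond_law Pr (fun w => coarse (x n w))
       (fun w => coarse (x (n + m)%N w)) (Q m))
  (Q_P2 : forall m, (0 < m)%N -> {ae mubar, forall y, P2 (Q m y)})
  (Pt : Theta -> nat -> d.-tuple R -> probability (d.-tuple R) R)
  (Pt_cond : forall theta m, (0 < m)%N ->
     regular_cond_law Pr (fun w => coarse (x n w))
       (fun w => model_orbit (F theta) (coarse (x n w))
                   (fun k => xi (n + k)%N w) m)
       (Pt theta m))
  (Pt_P2 : forall theta m, (0 < m)%N ->
     {ae mubar, forall y, P2 (Pt theta m y)})
  (* the score and the objective *)
  (S : probability (d.-tuple R) R -> d.-tuple R -> R)
  (S_scoring : scoring_rule S) (S_proper : strictly_proper S)
  (f := fun (theta : Theta) (m : nat) (y : d.-tuple R) =>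
          expected_score S (Pt theta m y) (Q m y))
  (L := fun (theta : Theta) (m : nat) =>
          (\int[mubar]_y (f theta m y)%:E)%E)
  (* assumptions 1 to 4 *)
  (Q_cvg : {ae mubar, forall y,
     W2 (Q m y) mubar @[m --> \oo] --> 0%E})
  (Pinf : Theta -> d.-tuple R -> probability (d.-tuple R) R)
  (Pt_cvg : forall theta, {ae mubar, forall y, P2 (Pinf theta y) /\
     W2 (Pt theta m y) (Pinf theta y) @[m --> \oo] --> 0%E})
  (S_cont : W2_jointly_continuous (expected_score S))
  (f_ui : forall theta,
     uniformly_integrable mubar (fun m : nat => f theta m.+1))
  (D := fun theta : Theta =>
          (\int[mubar]_y (score_divergence S (Pinf theta y) mubar)%:E)%E) :
  (forall theta,
     D theta \is a fin_num /\
     L theta m @[m --> \oo] --> (D theta + (\int[mubar]_y S mubar y)%:E)%E) /\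
  (forall theta theta',
     (L theta m - L theta' m)%E @[m --> \oo] --> (D theta - D theta')%E).
Proof.
pose c := expected_score S mubar mubar.
have L_cvg theta : exists g : d.-tuple R -> R,
    [/\ mubar.-integrable setT (EFin \o g),
      D theta = (\int[mubar]_y (g y)%:E - c%:E)%E &
      L theta m @[m --> \oo] --> (\int[mubar]_y (g y)%:E)%E].
  (* Conditional laws are constrained only at positive leads, hence the index [m.+1]; [cvg_shiftS]
     translates between the two indexings. *)
  have f_cvg : {ae mubar, forall y, f theta m.+1 y @[m --> \oo] -->
      expected_score S (Pinf theta y) mubar}.
    (* Countably many leads, so one null set serves them all. *)
    have Q2 : {ae mubar, forall y m, P2 (Q m.+1 y)}.
      by apply: ae_foralln => m; exact: Q_P2.
    have Pt2 : {ae mubar, forall y m, P2 (Pt theta m.+1 y)}.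
      by apply: ae_foralln => m; exact: Pt_P2.
    apply: filterS2 (filterI Q2 Pt2) (filterI Q_cvg (Pt_cvg theta)).
    move=> y [Q2y Pt2y] [Qy [Pinf2 Pty]].
    apply: W2_jointly_continuous_cvg => //.
    - by move: Pty; rewrite -cvg_shiftS.
    - by move: Qy; rewrite -cvg_shiftS.
  have [g [ig fg gcvg]] := vitali (f_ui theta) f_cvg.
  exists g; split => //; last by rewrite -cvg_shiftS.
  (* The divergence is replaced by [g] minus a constant, which is integrable, so that the integral
     can be split. *)
  have -> : D theta = (\int[mubar]_y ((g y)%:E - c%:E))%E.
    by apply: integral_ae_eq; apply: filterS fg => y; rewrite EFinB => <-.
  rewrite integralB//; last exact: finite_measure_integrable_cst.
  rewrite integral_cst//; congr (_ - _)%E; rewrite -[RHS]mule1.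
by congr (_ * _)%E; exact: (probability_setT mubar).
have D_fin theta : D theta \is a fin_num.
  have [g [ig -> _]] := L_cvg theta.
  by rewrite fin_numB (integrable_fin_num _ ig).
have L_D theta : L theta m @[m --> \oo] --> (D theta + c%:E)%E.
  by have [g [_ -> gcvg]] := L_cvg theta; rewrite subeK.
split=> [theta|theta theta']; first by split; [exact: D_fin|exact: L_D].
(* The parameter-free term [c] is finite and cancels. *)
have -> : (D theta - D theta' = (D theta + c%:E) - (D theta' + c%:E))%E.
  by rewrite fin_num_oppeD// addeACA subee// adde0.
(* Finiteness of both limits excludes the indeterminate form oo - oo. *)
by apply: cvgeB => //; rewrite fin_num_adde_defl// fin_numN fin_numD D_fin.
Qed.
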